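(* Let $X$ and $Y$ be finite nonempty sets, $F: X\to 2^Y$ a set-valued mapping, and let $(W_1,\ldots,W_m)$ and $(W'_1,\ldots,W'_{m'})$ be Hall partitions of $F$. Then $m = m'$ and there is a permutation $i_1,\ldots,i_m$ of $1,\ldots,m$ such that $W'_j = W_{i_j}$ for $j=1,\ldots,m$.
   Context: A set-valued mapping $F: X \to 2^Y$ assigns to each $x$ a (possibly empty) subset $F(x) \subset Y$; $F(W) = \bigcup_{x\in W}F(x)$; $\sharp$ is cardinality. For $W \subset X$, $F_W: X\setminus W \to 2^Y$ is $F_W(x) = F(x) \setminus F(W)$. For set-valued $G$ on a finite set, a subset $W$ of its domain is critical for $G$ if $W\ne\emptyset$ and $\sharp G(W)=\sharp W$; non-reducible for $G$ if $W\ne\emptyset$ and no proper subset of $W$ is critical for $G$. A tuple $(W_1,\ldots,W_m)$, $m\ge1$, is a Hall partition of $F$ if the $W_i$ are nonempty, pairwise disjoint with union $X$, and with $G_i = F_{W_1\cup\cdots\cup W_{i-1}}$ ($G_1=F$): (i) $G_i(x)\neq\emptyset$ for $x \in W_i$, all $i$; (ii) $W_i$ is non-reducible for $G_i$, all $i$; (iii) $W_i$ is critical for $G_i$ for $i \le m-1$. *)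

(* Defs.v *)
From mathcomp Require Import all_boot all_fingroup.

Set Implicit Arguments.
Unset Strict Implicit.
Unset Printing Implicit Defensive.

Section SetValuedMappings.

Variables X Y : finType.

(* A set-valued mapping whose domain is a subset D of X is given by D together
   with a total function G : X -> {set Y}; the values of G outside D are never
   used, as all the predicates below require their argument to lie in D. *)

Definition image_sv (G : X -> {set Y}) (W : {set X}) : {set Y} :=
  \bigcup_(x in W) G x.

(* The mapping F_W, with domain ~: W. *)
Definition residual (F : X -> {set Y}) (W : {set X}) : X -> {set Y} :=
  fun x => F x :\: image_sv F W.

Definition critical (D : {set X}) (G : X -> {set Y}) (W : {set X}) : Prop :=
  [/\ W \subset D, W != set0 & #|image_sv G W| = #|W|].

Definition nonreducible (D : {set X}) (G : X -> {set Y}) (W : {set X}) : Prop :=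
  [/\ W \subset D, W != set0
    & forall V : {set X}, V \proper W -> ~ critical D G V].

(* Indices start at 0: the union of the blocks strictly before block i. *)
Definition before (m : nat) (W : 'I_m -> {set X}) (i : 'I_m) : {set X} :=
  \bigcup_(j < m | j < i) W j.

Record Hall_partition (F : X -> {set Y}) (m : nat) (W : 'I_m -> {set X}) : Prop
  := HallPartition {
  Hall_length : 0 < m;
  Hall_nonempty : forall i, W i != set0;
  Hall_disjoint : forall i j, i != j -> [disjoint W i & W j];
  Hall_cover : \bigcup_(i < m) W i = [set: X];
  Hall_values : forall i x, x \in W i -> residual F (before W i) x != set0;
  Hall_nonreducible : forall i,
    nonreducible (~: before W i) (residual F (before W i)) (W i);
  Hall_critical : forall i : 'I_m, i.+1 < m ->
    critical (~: before W i) (residual F (before W i)) (W i)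
}.

End SetValuedMappings.

(* Main.v *)
Require Import Defs.
From mathcomp Require Import all_boot all_fingroup.

(** Call [A] tight when [#|F(A)| = #|A|].  A Hall partition forces Hall's
    condition [#|A| <= #|F(A)|] on every [A], so, by submodularity of
    [A |-> #|F(A)|], the tight sets are closed under union and intersection.
    The blocks of any Hall partition are then the classes of the equivalence
    relation "lying in the same tight sets", which depends on [F] only: the
    unions of initial blocks are tight and separate distinct blocks, while a
    tight set that splits a block would contradict its non-reducibility. *)

Section TightSets.

Set Implicit Arguments.
Unset Strict Implicit.

Variables X Y : finType.
Implicit Types (F G : X -> {set Y}) (A B D U V : {set X}).

Lemma image_sv0 F : image_sv F set0 = set0.
Proof. exact: big_set0. Qed.

Lemma image_svU F A B : image_sv F (A :|: B) = image_sv F A :|: image_sv F B.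
Proof. exact: bigcup_setU. Qed.

Lemma image_svS F A B : A \subset B -> image_sv F A \subset image_sv F B.
Proof. by move/setUidPr=> <-; rewrite image_svU subsetUl. Qed.

Lemma image_residual F U V :
  image_sv (residual F U) V = image_sv F V :\: image_sv F U.
Proof.
apply/setP=> y; rewrite inE.
apply/bigcupP/andP => [[x xV]|[yNU /bigcupP[x xV yx]]].
  by rewrite inE => /andP[-> yx]; split=> //; apply/bigcupP; exists x.
by exists x; rewrite // inE yNU.
Qed.

Lemma card_image_residual F U V :
  #|image_sv F (U :|: V)| = #|image_sv F U| + #|image_sv (residual F U) V|.
Proof.
by rewrite image_residual image_svU cardsU cardsD setIC addnBA //
  subset_leq_card ?subsetIl.
Qed.

Lemma card_image_submod F A B :
  #|image_sv F (A :|: B)| + #|image_sv F (A :&: B)|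
    <= #|image_sv F A| + #|image_sv F B|.
Proof.
rewrite image_svU -(cardsUI (image_sv F A)) leq_add2l; apply: subset_leq_card.
by rewrite subsetI !image_svS ?subsetIl ?subsetIr.
Qed.

(** In a smallest violator [V], deleting any point [x] gives [#|V| - 1 <= #|G(V :\ x)| <= #|G(V)| <
    #|V|], so [V :\ x] would be a critical proper subset of [U]. *)
Lemma nonreducible_Hall D G U V :
  nonreducible D G U -> {in U, forall x, G x != set0} ->
  V \subset U -> #|V| <= #|image_sv G V|.
Proof.
case=> sUD _ Unr Gn0.
have [n] := ubnP #|V|; elim: n V => // n IHn V ltVn sVU.
have [->|[x xV]] := set_0Vmem V; first by rewrite cards0.
rewrite leqNgt; apply/negP => ltGV.
have cV := cardsD1 x V; rewrite xV add1n in cV.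
have sV'U : V :\ x \subset U := subset_trans (subsetDl _ _) sVU.
have le1 : #|V :\ x| <= #|image_sv G (V :\ x)|.
  by apply: IHn => //; rewrite -ltnS -cV.
have le2 : #|image_sv G (V :\ x)| <= #|image_sv G V|.
  by rewrite subset_leq_card // image_svS // subsetDl.
rewrite cV ltnS in ltGV.
(* Critical sets are nonempty, so a singleton [V] is ruled out by [Gn0] instead. *)
have [V'0|V'n0] := eqVneq (V :\ x) set0.
  move: ltGV; rewrite V'0 cards0 leqn0 cards_eq0 => /eqP GV0.
  have /set0Pn[y yx] := Gn0 x (subsetP sVU x xV).
  have : y \in image_sv G V by apply/bigcupP; exists x.
  by rewrite GV0 inE.
apply: (Unr (V :\ x)).
  by apply/properP; split=> //; exists x; rewrite ?(subsetP sVU) // !inE eqxx.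
split=> //; first exact: subset_trans sUD.
by apply/eqP; rewrite eqn_leq le1 (leq_trans le2 ltGV).
Qed.

Definition tight F A := #|image_sv F A| == #|A|.

Lemma tight_residual F U V :
  [disjoint U & V] -> tight F U ->
  tight F (U :|: V) = (#|image_sv (residual F U) V| == #|V|).
Proof.
move=> dUV /eqP tU; rewrite /tight card_image_residual tU.
by rewrite cardsU disjoint_setI0 // cards0 subn0 eqn_add2l.
Qed.

Definition tight_class F (x : X) : {set X} :=
  [set y | [forall A, tight F A ==> ((x \in A) == (y \in A))]].

End TightSets.

Section HallPartition.

Set Implicit Arguments.
Unset Strict Implicit.

Variables X Y : finType.
Variables (F : X -> {set Y}) (m : nat) (W : 'I_m -> {set X}).
Hypothesis hW : Hall_partition F W.
Implicit Types (A B : {set X}) (i : 'I_m) (x : X).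

(** Indexed by [nat] so that [prefix m] makes sense; at an ordinal [i] it is convertible to
    [before W i]. *)
Let prefix n : {set X} := \bigcup_(j < m | j < n) W j.

Let prefix0 : prefix 0 = set0.
Proof. by rewrite /prefix big_pred0. Qed.

Let prefixS (i : 'I_m) : prefix i.+1 = prefix i :|: W i.
Proof.
rewrite /prefix (bigD1 i) //= setUC; congr (_ :|: _); apply: eq_bigl => j.
by rewrite ltnS [RHS]ltn_neqAle andbC.
Qed.

Let prefix_full : prefix m = [set: X].
Proof. by rewrite -(Hall_cover hW); apply: eq_bigl => j; rewrite ltn_ord. Qed.

Let prefix_disjoint (i : 'I_m) : [disjoint prefix i & W i].
Proof.
rewrite disjoint_sym; apply: bigcup_disjoint => j ji; apply: (Hall_disjoint hW).
by rewrite -val_eqE neq_ltn ji orbT.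
Qed.

Lemma Hall_partition_Hall A : #|A| <= #|image_sv F A|.
Proof.
suff: forall n, n <= m -> #|A :&: prefix n| <= #|image_sv F (A :&: prefix n)|.
  by move/(_ m (leqnn m)); rewrite prefix_full setIT.
elim=> [|n IHn] ltnm; first by rewrite prefix0 setI0 cards0.
pose i := Ordinal ltnm; have := prefixS i; rewrite /= => ->.
rewrite setIUr card_image_residual (leq_trans (leq_card_setU _ _)) //.
apply: leq_add; first exact: IHn (ltnW ltnm).
(* Removing the image of all of [prefix i], not only of its part in [A], can only shrink what
   remains, and there non-reducibility of [W i] applies. *)
apply: leq_trans (_ : #|image_sv (residual F (prefix i)) (A :&: W i)| <= _).
  apply: (nonreducible_Hall (Hall_nonreducible hW i)) (subsetIr _ _).
  exact: (Hall_values hW).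
rewrite !image_residual subset_leq_card // setDS // image_svS //.
exact: subsetIr.
Qed.

(** Each step adds a critical block. The bound is strict because the last block need not be
    critical. *)
Let tight_prefix n : n < m -> tight F (prefix n).
Proof.
elim: n => [|n IHn] ltnm; first by rewrite prefix0 /tight image_sv0 !cards0.
pose i := Ordinal (ltnW ltnm); have := prefixS i; rewrite /= => ->.
rewrite (tight_residual (prefix_disjoint i) (IHn (ltnW ltnm))).
by have [_ _ /eqP] := Hall_critical hW (i := i) ltnm.
Qed.

(** Submodularity bounds the sum of the two image sizes from above, Hall's condition bounds each
    from below, and the bounds meet. *)
Lemma tightUI A B : tight F A -> tight F B ->
  tight F (A :|: B) /\ tight F (A :&: B).
Proof.
move=> /eqP tA /eqP tB; have := card_image_submod F A B.
rewrite tA tB -(cardsUI A) => le.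
have leU := Hall_partition_Hall (A :|: B).
have leI := Hall_partition_Hall (A :&: B).
split; rewrite /tight eqn_leq ?leU ?leI andbT.
  by rewrite -(leq_add2r #|A :&: B|) (leq_trans _ le) // leq_add2l.
by rewrite -(leq_add2l #|A :|: B|) (leq_trans _ le) // leq_add2r.
Qed.

Let tight_prefix_block A (i : 'I_m) :
  tight F A -> tight F (prefix i :|: (A :&: W i)).
Proof.
move=> tA; have [tU _] := tightUI (tight_prefix (ltn_ord i)) tA.
have -> : prefix i :|: (A :&: W i) = (prefix i :|: A) :&: prefix i.+1.
  by rewrite prefixS -setUIr.
(* For the last block [prefix i.+1] may fail to be tight, but it is all of [X] and the intersection
   disappears. *)
have [ltim|leim] := ltnP i.+1 m.
  by have [] := tightUI tU (tight_prefix ltim).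
have -> : i.+1 = m by apply/eqP; rewrite eqn_leq leim andbT.
by rewrite prefix_full setIT.
Qed.

(** Tightness of [prefix i :|: (A :&: W i)] makes the nonempty set [A :&: W i] critical for the
    residual mapping, so it cannot be a proper subset of [W i]. *)
Lemma tight_block A i x :
  tight F A -> x \in W i -> x \in A -> W i \subset A.
Proof.
move=> tA xW xA.
have dUV : [disjoint prefix i & A :&: W i].
  exact: disjointWr (subsetIr _ _) (prefix_disjoint i).
have := tight_prefix_block i tA; rewrite tight_residual ?tight_prefix //.
move=> /eqP crit; have [sWD _ Wnr] := Hall_nonreducible hW i.
have := subsetIr A (W i); rewrite subEproper => /predU1P[<-|ltV].
  exact: subsetIl.
case: (Wnr _ ltV); split=> //; first exact: subset_trans (subsetIr _ _) sWD.
by apply/set0Pn; exists x; rewrite inE xA.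
Qed.

Lemma block_tight_class i x : x \in W i -> W i = tight_class F x.
Proof.
move=> xi; apply/setP=> y; rewrite inE; apply/idP/forallP => [yi A | eqxy].
  apply/implyP => tA; apply/eqP; apply/idP/idP => [xA | yA].
    exact: subsetP (tight_block tA xi xA) y yi.
  exact: subsetP (tight_block tA yi yA) x xi.
(* The prefix ending just before the later block separates two distinct blocks. *)
have sep (j k : 'I_m) z t : j < k -> z \in W j -> t \in W k ->
    exists2 A, tight F A & (z \in A) && (t \notin A).
  move=> jk zj tk; exists (prefix k); first exact: tight_prefix.
  rewrite (disjointFl (prefix_disjoint k) tk) andbT.
  by apply/bigcupP; exists j.
have /bigcupP[k _ yk] : y \in \bigcup_(k < m) W k by rewrite (Hall_cover hW).
have [ik|ki|/val_inj-> //] := ltngtP i k.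
  have [A tA /andP[xA yA]] := sep i k x y ik xi yk.
  by have := eqxy A; rewrite tA xA (negPf yA).
have [A tA /andP[yA xA]] := sep k i y x ki yk xi.
by have := eqxy A; rewrite tA yA (negPf xA).
Qed.

Lemma block_inj : injective W.
Proof.
move=> i j eqW; apply: contraNeq (Hall_nonempty hW i) => /(Hall_disjoint hW).
by rewrite -eqW -setI_eq0 setIid.
Qed.

(** The right-hand side does not mention [W], so any two Hall partitions of [F] have the same set of
    blocks. *)
Lemma codom_blocks : [set W i | i : 'I_m] = [set tight_class F x | x : X].
Proof.
apply/setP=> B; apply/imsetP/imsetP => [[i _ ->]|[x _ ->]].
  have /set0Pn[x xi] := Hall_nonempty hW i.
  by exists x; last exact: block_tight_class.
have /bigcupP[i _ xi] : x \in \bigcup_(i < m) W i by rewrite (Hall_cover hW).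
by exists i; rewrite // (block_tight_class xi).
Qed.

Lemma card_blocks : #|[set tight_class F x | x : X]| = m.
Proof. by rewrite -codom_blocks card_imset ?card_ord //; exact: block_inj. Qed.

End HallPartition.

Theorem theorem6p1 (X Y : finType) (hX : 0 < #|X|) (hY : 0 < #|Y|)
  (F : X -> {set Y})
  (m : nat) (W : 'I_m -> {set X}) (m' : nat) (W' : 'I_m' -> {set X})
  (hW : Hall_partition F W) (hW' : Hall_partition F W') :
  exists (e : m = m') (s : 'S_m),
    forall j : 'I_m, W' (cast_ord e j) = W (s j).
Proof.
have e : m = m' by rewrite -(card_blocks hW) (card_blocks hW').
(* Eliminating [e] indexes both families by ['I_m] and makes the cast trivial. *)
exists e; case: _ / e W' hW' => W' hW'.
have ex j : exists i, W i == W' j.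
  have: W' j \in [set W i | i : 'I_m].
    by rewrite (codom_blocks hW) -(codom_blocks hW') imset_f.
  by case/imsetP=> i _ ->; exists i.
pose f j := xchoose (ex j).
have fE j : W (f j) = W' j by apply/eqP/(xchooseP (ex j)).
have f_inj : injective f.
  by move=> i j eqf; apply: (block_inj hW'); rewrite -!fE eqf.
by exists (perm f_inj) => j; rewrite permE fE cast_ord_id.
Qed.
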